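(* Let $N$ be a simply connected nilpotent Lie group with a left invariant symplectic structure $\omega$. Then $(N,\omega)$ does not admit any compatible left invariant metric with hermitian Ricci tensor, unless $N$ is abelian.
   Context: Let $\mathfrak{n}$ be the Lie algebra of $N$, of dimension $2n$. A left invariant symplectic structure is determined by a non-degenerate 2-form $\omega$ on $\mathfrak{n}$ with $\omega([X,Y],Z)+\omega([Y,Z],X)+\omega([Z,X],Y)=0$ for all $X,Y,Z\in\mathfrak{n}$. A left invariant Riemannian metric, given by an inner product $\langle\cdot,\cdot\rangle$ on $\mathfrak{n}$, is compatible with $(N,\omega)$ if the endomorphism $J$ of $\mathfrak{n}$ defined by $\omega(X,Y)=\langle X,JY\rangle$ satisfies $J^2=-I$. A compatible metric has hermitian Ricci tensor if its Ricci operator $\mathrm{Ric}$ on $\mathfrak{n}$ satisfies $\mathrm{Ric}\,J=J\,\mathrm{Ric}$. *)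

(* Defs.v *)
From HB Require Import structures.
From mathcomp Require Import all_boot all_order all_algebra.
From mathcomp Require Import reals ring lra.

Set Implicit Arguments.
Unset Strict Implicit.
Unset Printing Implicit Defensive.

Import Order.TTheory GRing.Theory Num.Theory.
Local Open Scope ring_scope.

(* A simply connected nilpotent Lie group N is given by its Lie algebra: a
   finite-dimensional real vector space L with a nilpotent Lie bracket.  Left
   invariant forms and metrics on N are forms and inner products on L. *)

Section LieAlgebra.
Variables (F : fieldType) (L : vectType F) (br : {bilinear L -> L -> L}).

Definition lie_bracket : Prop :=
  (forall X, br X X = 0) /\
  (forall X Y Z, br X (br Y Z) + br Y (br Z X) + br Z (br X Y) = 0).

Definition lie_prodv (U V : {vspace L}) : {vspace L} :=
  <<[seq br u v | u <- vbasis U, v <- vbasis V]>>%VS.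

Fixpoint lower_central (k : nat) : {vspace L} :=
  if k is k'.+1 then lie_prodv fullv (lower_central k') else fullv.

Definition lie_nilpotent : Prop := exists k, lower_central k = 0%VS.

Definition lie_abelian : Prop := forall X Y, br X Y = 0.

Lemma memv_lie_prodv (U V : {vspace L}) u v :
  u \in U -> v \in V -> br u v \in lie_prodv U V.
Proof.
move=> /coord_vbasis-> /coord_vbasis->.
rewrite linear_sumlz; apply: memv_suml => i _.
rewrite linear_sumr; apply: memv_suml => j _.
rewrite linearZl_LR linearZr_LR !memvZ ?memv_span //.
by apply: allpairs_f; rewrite mem_nth // size_tuple.
Qed.

Lemma lie_prodv_sub (U V W : {vspace L}) :
  (forall u v, u \in U -> v \in V -> br u v \in W) -> (lie_prodv U V <= W)%VS.
Proof.
move=> sW; apply/span_subvP => _ /allpairsP[[u v] /= [uU vV ->]].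
by apply: sW; apply: vbasis_mem.
Qed.

Lemma lie_skew : lie_bracket -> forall X Y, br Y X = - br X Y.
Proof.
case=> alt _ X Y; apply/eqP; rewrite -addr_eq0; apply/eqP.
by have := alt (X + Y); rewrite linearDl !linearDr !alt add0r addr0 addrC.
Qed.

(* The differential of omega vanishes. *)
Definition lie_closed (omega : {skew_symmetric L}) : Prop :=
  forall X Y Z,
    omega (br X Y) Z + omega (br Y Z) X + omega (br Z X) Y = 0.

Definition left_invariant_symplectic (omega : {skew_symmetric L}) : Prop :=
  nondegenerate omega /\ lie_closed omega.

End LieAlgebra.

Definition lftrace (F : fieldType) (V : vectType F) (f : 'End(V)) : F :=
  \tr (passmx.mxof (vbasis fullv) (vbasis fullv) f).

Lemma lftrace_linear (F : fieldType) (V : vectType F) :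
  scalar (@lftrace F V).
Proof. by move=> a f h; rewrite /lftrace passmx.mxof_linear linearP. Qed.

Section LinfunP.
Variables (R : fieldType) (U V : vectType R).

Lemma linfunP (f : U -> V) : linear f -> linfun f =1 f.
Proof.
move=> fL x; pose fm := GRing.isLinear.Build _ _ _ _ f fL.
pose f' : {linear U -> V} := HB.pack f fm.
by rewrite -[f]/(f' : _ -> _) lfunE.
Qed.

End LinfunP.

Section Metric.
Variables (R : realFieldType) (L : vectType R).
Variable g : {dot L for idfun}.

Definition flat : 'Hom(L, 'Hom(L, R^o)) :=
  linfun (fun X => linfun (g X : L -> R^o)).

Definition sharp : 'Hom('Hom(L, R^o), L) := (flat^-1)%VF.

Lemma metricC X Y : g X Y = g Y X.
Proof. by rewrite hermC expr0 mul1r. Qed.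

Lemma metric_inj X Y : (forall Z, g X Z = g Y Z) -> X = Y.
Proof.
move=> gXY; apply/eqP; rewrite -subr_eq0; apply/negPn/negP => /(neq0_dnorm_gt0 (s := g)).
by rewrite linearBl /= gXY subrr ltxx.
Qed.

Lemma flatE X Y : flat X Y = g X Y.
Proof.
have gL Z : linear (g Z : L -> R^o) by move=> a U V; rewrite linearPr.
rewrite /flat linfunP ?linfunP // => a U V; apply/lfunP => Z.
by rewrite add_lfunE scale_lfunE !linfunP // linearPl.
Qed.

Lemma sharpE (phi : 'Hom(L, R^o)) X : g (sharp phi) X = phi X.
Proof.
have ker0 : lker flat == 0%VS.
  apply/lker0P => X1 X2 eqX; apply: metric_inj => Z.
  by rewrite -!flatE eqX.
have im : limg flat = fullv.
  apply/eqP; rewrite eqEdim subvf /= limg_dim_eq ?(eqP ker0) ?capv0 //.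
  by rewrite !dimvf /= /dim /= muln1.
by rewrite -flatE /sharp limg_lfunVK // im memvf.
Qed.

End Metric.

Section LeviCivita.
Variables (R : realFieldType) (L : vectType R) (br : {bilinear L -> L -> L}).
Variable g : {dot L for idfun}.

(* Koszul formula; the derivative terms vanish on left invariant fields. *)
Definition koszul X Y Z : R :=
  2^-1 * (g (br X Y) Z - g (br Y Z) X + g (br Z X) Y).

Definition levi_civita X Y : L := sharp g (linfun (koszul X Y : L -> R^o)).

Definition curvature X Y Z : L :=
  levi_civita X (levi_civita Y Z) - levi_civita Y (levi_civita X Z)
  - levi_civita (br X Y) Z.

Definition ricci X Y : R := lftrace (linfun (fun Z => curvature Z X Y)).

Definition ricci_op : 'End(L) :=
  linfun (fun X => sharp g (linfun (ricci X : L -> R^o))).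

Lemma levi_civitaE X Y Z : g (levi_civita X Y) Z = koszul X Y Z.
Proof.
rewrite sharpE linfunP // => a Z1 Z2; rewrite /koszul /GRing.scale /=.
rewrite !(linearPl, linearPr) /GRing.scale /=; ring.
Qed.

Lemma levi_civita_linearl Y : linear (levi_civita^~ Y).
Proof.
move=> a X1 X2; apply: (@metric_inj _ _ g) => Z.
rewrite linearPl /= !levi_civitaE /koszul !(linearPl, linearPr) /=; ring.
Qed.

Lemma levi_civita_linearr X : linear (levi_civita X).
Proof.
move=> a X1 X2; apply: (@metric_inj _ _ g) => Z.
rewrite linearPl /= !levi_civitaE /koszul !(linearPl, linearPr) /=; ring.
Qed.

Lemma levi_civita_torsion_free : lie_bracket br ->
  forall X Y, levi_civita X Y - levi_civita Y X = br X Y.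
Proof.
move=> lie X Y; apply: (@metric_inj _ _ g) => Z.
rewrite linearBl /= !levi_civitaE /koszul.
rewrite (lie_skew lie X Y) (lie_skew lie X Z) (lie_skew lie Y Z) !linearNl /=.
by field.
Qed.

Lemma levi_civita_metric : lie_bracket br ->
  forall X Y Z, g (levi_civita X Y) Z + g Y (levi_civita X Z) = 0.
Proof.
move=> lie X Y Z; rewrite [g Y _]metricC !levi_civitaE /koszul.
rewrite (lie_skew lie X Y) (lie_skew lie X Z) (lie_skew lie Y Z) !linearNl /=.
by ring.
Qed.

Lemma levi_civita_unique (D : L -> L -> L) : lie_bracket br ->
  (forall X Y, D X Y - D Y X = br X Y) ->
  (forall X Y Z, g (D X Y) Z + g Y (D X Z) = 0) ->
  forall X Y, D X Y = levi_civita X Y.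
Proof.
move=> lie tor met X Y; apply: (@metric_inj _ _ g) => Z.
rewrite levi_civitaE /koszul -!tor !linearBl /=.
have mXYZ := met X Y Z; have mYXZ := met Y X Z; have mZXY := met Z X Y.
rewrite [g Y _]metricC in mXYZ; rewrite [g X _]metricC in mYXZ.
rewrite [g X _]metricC in mZXY.
by lra.
Qed.

Lemma curvature_linear1 X Y : linear (fun Z => curvature Z X Y).
Proof.
move=> a Z1 Z2; rewrite /curvature !levi_civita_linearl linearPl /=.
rewrite !(levi_civita_linearl, levi_civita_linearr) !scalerBr !opprD.
by rewrite (addrACA (a *: _)) (addrACA (a *: _ + - (a *: _))) ?addrA.
Qed.

Lemma curvature_linear2 Z Y : linear (fun X => curvature Z X Y).
Proof.
move=> a X1 X2; rewrite /curvature !levi_civita_linearl linearPr /=.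
rewrite !(levi_civita_linearl, levi_civita_linearr) !scalerBr !opprD.
by rewrite (addrACA (a *: _)) (addrACA (a *: _ + - (a *: _))) ?addrA.
Qed.

Lemma curvature_linear3 Z X : linear (curvature Z X).
Proof.
move=> a Y1 Y2; rewrite /curvature !levi_civita_linearr.
rewrite !scalerBr !opprD.
by rewrite (addrACA (a *: _)) (addrACA (a *: _ + - (a *: _))) ?addrA.
Qed.

Lemma ricci_linearr X : scalar (ricci X).
Proof.
move=> a Y1 Y2; rewrite /ricci -lftrace_linear; congr lftrace.
apply/lfunP => Z; rewrite add_lfunE scale_lfunE !(linfunP (curvature_linear1 _ _)).
exact: curvature_linear3.
Qed.

Lemma ricci_linearl Y : scalar (ricci^~ Y).
Proof.
move=> a X1 X2; rewrite /ricci -lftrace_linear; congr lftrace.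
apply/lfunP => Z; rewrite add_lfunE scale_lfunE !(linfunP (curvature_linear1 _ _)).
exact: curvature_linear2.
Qed.

Lemma ricci_opE X Y : g (ricci_op X) Y = ricci X Y.
Proof.
have rL Z : linear (ricci Z : L -> R^o) by move=> a U V; rewrite ricci_linearr.
rewrite /ricci_op linfunP => [|a U V].
  by rewrite sharpE linfunP.
apply: (@metric_inj _ _ g) => Z.
by rewrite linearPl /= !sharpE !linfunP //= ricci_linearl.
Qed.

End LeviCivita.

Section Compatible.
Variables (R : realFieldType) (L : vectType R) (br : {bilinear L -> L -> L}).
Variables (omega : {skew_symmetric L}) (g : {dot L for idfun}).

Definition assoc_endo : 'End(L) :=
  linfun (fun Y => sharp g (linfun (applyr omega Y : L -> R^o))).

Lemma assoc_endoE X Y : omega X Y = g X (assoc_endo Y).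
Proof.
have applyr_lin Z : linear (applyr omega Z : L -> R^o).
  by move=> a U V; rewrite /applyr /= linearPl.
rewrite /assoc_endo linfunP => [|a U V].
  by rewrite metricC sharpE linfunP.
apply: (@metric_inj _ _ g) => Z.
by rewrite linearPl /= !sharpE !linfunP //= linearPr.
Qed.

Definition compatible : Prop := (assoc_endo \o assoc_endo = - \1)%VF.

Definition hermitian_ricci : Prop :=
  (ricci_op br g \o assoc_endo = assoc_endo \o ricci_op br g)%VF.

End Compatible.

(* Main.v *)
Require Import Defs.
From mathcomp Require Import all_boot all_order all_algebra.
From mathcomp Require Import reals.
From mathcomp Require Import ring.

(** Write [D] for the Levi-Civita connection.  Whenever [D X X = 0], the
    endomorphism [A = D^~ X] satisfies [ricci X X = - tr (A ^ 2)].  If [Z] is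
    central then [A] is skew-symmetric, so [ricci Z Z >= 0], with equality only
    if [Z] is orthogonal to all brackets; if [X] is orthogonal to all brackets
    then [A] is symmetric, so [ricci X X <= 0].  Closedness of [omega] says that
    [J] maps central vectors to vectors orthogonal to all brackets, and a
    hermitian Ricci tensor satisfies [ricci (J Z) (J Z) = ricci Z Z]; hence all
    central vectors are orthogonal to all brackets.  But the last nonzero term
    of the lower central series is central, and consists of sums of brackets
    when the algebra is nilpotent and not abelian. *)

Set Implicit Arguments.
Unset Strict Implicit.
Unset Printing Implicit Defensive.

Import Order.TTheory GRing.Theory Num.Theory.
Local Open Scope ring_scope.

Section Trace.
Variables (F : fieldType) (V : vectType F).
Implicit Types f h : 'End(V).

Lemma lftraceB f h : lftrace (f - h) = lftrace f - lftrace h.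
Proof. by rewrite addrC -scaleN1r lftrace_linear mulN1r addrC. Qed.

Lemma lftraceC f h : lftrace (f \o h) = lftrace (h \o f).
Proof.
by rewrite /lftrace !(passmx.mxof_comp _ _ (vbasisP _)) mxtrace_mulC.
Qed.

Lemma lftrace_coord (e : (\dim {:V}).-tuple V) f : basis_of fullv e ->
  lftrace f = \sum_i coord e i (f e`_i).
Proof.
move=> eB; have bB := vbasisP {:V}.
(* Factoring [f] as [\1 \o f] through the basis [e] and using cyclicity of the matrix trace replaces
   [vbasis] by [e]. *)
rewrite /lftrace -[f in LHS]comp_lfun1l (passmx.mxof_comp _ _ eB).
rewrite mxtrace_mulC -(passmx.mxof_comp _ _ bB) comp_lfun1r.
by apply: eq_bigr => i _; rewrite !mxE /= passmx.vecof_delta.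
Qed.

End Trace.

Section MetricTrace.
Variables (R : realFieldType) (L : vectType R) (g : {dot L for idfun}).

Lemma metric_ge0 X : 0 <= g X X.
Proof.
have [->|/(neq0_dnorm_gt0 (s := g))/ltW//] := eqVneq X 0.
by rewrite linear0r.
Qed.

Lemma metric_eq0 X : g X X = 0 -> X = 0.
Proof.
move=> gXX; apply/eqP/negPn/negP => /(neq0_dnorm_gt0 (s := g)).
by rewrite gXX ltxx.
Qed.

(** Gram-Schmidt by induction on the dimension: split off a nonzero [v] and pass to its orthogonal
    complement in [U]. The vectors stay unnormalised, since a real field may lack square roots. *)
Lemma orthogonal_basis_seq (U : {vspace L}) :
  exists2 e : seq L, basis_of U e & pairwise (fun u v => g u v == 0) e.
Proof.
have [m] := ubnP (\dim U); elim: m U => // m IHm U dimU.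
have [->|U0] := eqVneq U 0%VS; first by exists [::] => //; apply: nil_basis.
set v := vpick U; have vU : v \in U by apply: memv_pick.
have gv0 : g v v != 0.
  by apply/eqP => /metric_eq0/eqP; rewrite vpick0 (negPf U0).
have vNU : v \notin orthov g U by apply/mem_orthovPn; exists v.
have dimW := eq_dim_orthov1 vNU; set W := (U :&: _)%VS in dimW.
have U_gt0 : (0 < \dim U)%N by rewrite lt0n dimv_eq0.
have [|e eB e_orth] := IHm W; first by rewrite -dimW prednK.
have eW u : u \in e -> u \in W by apply: basis_mem.
exists (v :: e) => /=; last first.
  rewrite e_orth andbT; apply/allP => u /eW.
  by rewrite memv_cap mem_orthov1 metricC => /andP[].
rewrite basisEfree free_cons (basis_free eB) (span_basis eB) andbT.
rewrite memv_cap mem_orthov1 (negPf gv0) andbF /=; apply/andP; split.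
  apply/span_subvP => u; rewrite inE => /predU1P[->//|/eW].
  by rewrite memv_cap => /andP[].
by rewrite -[size e](size_basis (X := in_tuple e) eB) -dimW prednK.
Qed.

Lemma lftrace_orthogonal : exists2 e : seq L, basis_of fullv e &
  forall f : 'End(L), lftrace f = \sum_(v <- e) g (f v) v / g v v.
Proof.
have [s sB s_orth] := orthogonal_basis_seq fullv.
have sz : size s == \dim {:L} by rewrite (size_basis (X := in_tuple s) sB).
pose e := Tuple sz; have eB : basis_of fullv e by [].
exists s => // f; rewrite (lftrace_coord f eB) (big_nth 0) (eqP sz) big_mkord.
apply: eq_bigr => i _.
have e0 : g e`_i e`_i != 0.
  apply/eqP => /metric_eq0/eqP; apply/negP/(free_not0 (basis_free eB)).
  by rewrite mem_nth ?size_tuple.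
rewrite [f _ in RHS](coord_basis eB) ?memvf // linear_sumlz (bigD1 i) //=.
rewrite big1 ?addr0 ?linearZl_LR /= ?mulfK //= => j ji.
have [ij|ij] : (i < j)%N \/ (j < i)%N.
- by apply/orP; rewrite -neq_ltn eq_sym.
- rewrite linearZl_LR /= metricC (eqP (pairwiseP 0 s_orth _ _ _ _ ij)) ?mulr0 //.
    by rewrite inE (eqP sz).
  by rewrite inE (eqP sz).
- rewrite linearZl_LR /= (eqP (pairwiseP 0 s_orth _ _ _ _ ij)) ?mulr0 //.
    by rewrite inE (eqP sz).
  by rewrite inE (eqP sz).
Qed.

(** In an orthogonal basis the trace is the sum of the terms [g (f v) (f v) / g v v]. *)
Lemma lftrace_sqr_sym (f : 'End(L)) :
  (forall X Y, g (f X) Y = g X (f Y)) -> 0 <= lftrace (f \o f).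
Proof.
move=> fS; have [e _ ->] := lftrace_orthogonal.
by apply: sumr_ge0 => v _; rewrite comp_lfunE fS divr_ge0 ?metric_ge0.
Qed.

(** The same sum now carries a minus sign, so all its terms vanish and [f] kills a basis. *)
Lemma lftrace_sqr_skew (f : 'End(L)) :
  (forall X Y, g (f X) Y + g X (f Y) = 0) -> 0 <= lftrace (f \o f) -> f = 0.
Proof.
move=> fS; have [e eB ->] := lftrace_orthogonal => tr_ge0.
have ge0 v : 0 <= g (f v) (f v) / g v v by rewrite divr_ge0 ?metric_ge0.
have tr0 : \sum_(v <- e) g (f v) (f v) / g v v = 0.
  apply/eqP; rewrite eq_le sumr_ge0 ?andbT //; move: tr_ge0.
  rewrite -oppr_ge0 -sumrN; congr (_ <= _); apply: eq_bigr => v _.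
  by rewrite comp_lfunE -mulNr; congr (_ / _); apply/eqP; rewrite -addr_eq0 fS.
apply/lfunP => X; rewrite zero_lfunE; apply/eqP; rewrite -memv_ker.
suff /subvP/(_ X (memvf X)) : (fullv <= lker f)%VS by [].
rewrite -(span_basis eB); apply/span_subvP => v ve; rewrite memv_ker.
have /eqP := tr0; rewrite psumr_eq0 // => /allP/(_ v ve) /=.
rewrite mulf_eq0 invr_eq0 => /orP[|] /eqP/metric_eq0 => [->//|->].
by rewrite linear0.
Qed.

End MetricTrace.

Section Ricci.
Variables (R : realFieldType) (L : vectType R) (br : {bilinear L -> L -> L}).
Variable g : {dot L for idfun}.
Hypothesis lie : lie_bracket br.

Local Notation D := (levi_civita br g).

(** With [K = D X], torsion-freeness gives [br W X = A W - K W], so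
    [curvature W X X = (A K - K A - A ^ 2) W]; the commutator has trace zero. *)
Lemma ricci_sqr X : D X X = 0 ->
  ricci br g X X = - lftrace (linfun (D^~ X) \o linfun (D^~ X)).
Proof.
move=> DXX; set A := linfun _; pose K := linfun (D X).
have AE W : A W = D W X by rewrite linfunP //; apply: levi_civita_linearl.
have KE W : K W = D X W by rewrite linfunP //; apply: levi_civita_linearr.
have D0 W : D W 0 = 0.
  by rewrite -(linfunP (@levi_civita_linearr _ _ br g W)) linear0.
rewrite /ricci (_ : linfun _ = ((A \o K) - (K \o A) - (A \o A))%VF).
  by rewrite !lftraceB (lftraceC A K) subrr sub0r.
apply/lfunP => W; rewrite linfunP; last exact: curvature_linear1.
rewrite !(add_lfunE, opp_lfunE, comp_lfunE) /curvature DXX D0.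
rewrite -(levi_civita_torsion_free g lie) -!AE -!KE linearB /= sub0r.
by rewrite opprB addrA [- _ + _]addrC.
Qed.

(** Centrality leaves a single Koszul term, which is antisymmetric in [X] and [Y]. *)
Lemma levi_civita_central Z : (forall W, br Z W = 0) ->
  forall X Y, g (D X Z) Y = 2^-1 * g (br Y X) Z.
Proof.
move=> Zc X Y; rewrite levi_civitaE /koszul Zc (lie_skew lie Z X) Zc oppr0.
by rewrite !linear0l subr0 add0r.
Qed.

Lemma ricci_central_le0 Z : (forall W, br Z W = 0) -> ricci br g Z Z <= 0 ->
  forall X Y, g Z (br X Y) = 0.
Proof.
move=> Zc; have DZ := levi_civita_central Zc.
have AE W : linfun (D^~ Z) W = D W Z.
  by rewrite linfunP //; apply: levi_civita_linearl.
rewrite ricci_sqr ?oppr_le0 => [/(lftrace_sqr_skew (g := g))A0 X Y|]; last first.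
  apply: (@metric_inj _ _ g) => Y.
  by rewrite DZ (lie_skew lie Z Y) Zc oppr0 !linear0l mulr0.
(* Once [D^~ Z] is zero, its formula says that [Z] is orthogonal to [br X Y]. *)
have := DZ Y X; rewrite -AE A0 => [|U V].
  rewrite zero_lfunE linear0l metricC => /esym/eqP.
  by rewrite mulf_eq0 invr_eq0 pnatr_eq0 /= => /eqP.
rewrite !AE DZ [g U _]metricC DZ (lie_skew lie U V) linearNl /=; ring.
Qed.

Lemma ricci_orthogonal_le0 X : (forall U V, g X (br U V) = 0) ->
  ricci br g X X <= 0.
Proof.
move=> Xo; have Xo' U V : g (br U V) X = 0 by rewrite metricC.
(* Orthogonality to brackets kills the Koszul term antisymmetric in [U] and [V]; exchanging them
   swaps the other two. *)
have DX U V : g (D U X) V = 2^-1 * (g (br U X) V + g (br V X) U).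
  rewrite levi_civitaE /koszul Xo' addr0 (lie_skew lie V X) linearNl /=.
  by rewrite opprK.
have AE W : linfun (D^~ X) W = D W X.
  by rewrite linfunP //; apply: levi_civita_linearl.
rewrite ricci_sqr ?oppr_le0; last first.
  by apply: (@metric_inj _ _ g) => Y; rewrite DX Xo' addr0 lie.1 !linear0l mulr0.
apply: (lftrace_sqr_sym (g := g)) => U V.
by rewrite !AE DX [g U _]metricC DX [_ + g (br V X) U]addrC.
Qed.

End Ricci.

Section Nilpotent.
Variables (R : realFieldType) (L : vectType R) (br : {bilinear L -> L -> L}).
Variable g : {dot L for idfun}.
Hypothesis (lie : lie_bracket br).

Lemma lie_abelian_center_orthogonal : lie_nilpotent br ->
  (forall Z, (forall W, br Z W = 0) -> forall X Y, g Z (br X Y) = 0) ->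
  lie_abelian br.
Proof.
case=> k lck Zo; suff lc1 : lower_central br 1 = 0%VS.
  move=> X Y; apply/eqP; rewrite -memv0 -lc1.
  by apply: memv_lie_prodv; apply: memvf.
case: k lck => [lc0|k].
  apply/eqP; rewrite -subv0; apply: lie_prodv_sub => u v _ _.
  by rewrite -lc0 memvf.
(* Descent: when term [k.+2] is zero, term [k.+1] is central and, being spanned by brackets,
   orthogonal to itself. *)
elim: k => // k IHk lck; apply: IHk; apply/eqP; rewrite -subv0.
apply/subvP => Z Zk; rewrite memv0; apply/eqP/(metric_eq0 (g := g)).
have Zc W : br Z W = 0.
  rewrite (lie_skew lie W Z); apply/eqP; rewrite oppr_eq0 -memv0 -lck.
  by apply: memv_lie_prodv => //; apply: memvf.
suff /subvP/(_ Z Zk) : (lower_central br k.+1 <= orthov g <[Z]>)%VS.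
  by rewrite mem_orthov1 => /eqP.
apply: lie_prodv_sub => u v _ _.
by rewrite mem_orthov1; apply/eqP/(etrans (metricC g _ _))/Zo.
Qed.

End Nilpotent.

Theorem proposition5p1 (R : realType) (n : nat) (L : vectType R)
    (br : {bilinear L -> L -> L}) (omega : {skew_symmetric L}) :
  \dim {:L} = n.*2 ->
  lie_bracket br ->
  lie_nilpotent br ->
  left_invariant_symplectic br omega ->
  ~ lie_abelian br ->
  ~ (exists g : {dot L for idfun},
       compatible omega g /\ hermitian_ricci br omega g).
Proof.
move=> _ lie nil [_ closed] nab [g [comp herm]]; apply: nab.
apply: (lie_abelian_center_orthogonal (g := g)) => // Z Zc.
apply: (ricci_central_le0 lie) => //.
set J := assoc_endo omega g in comp herm.
have JJ X : J (J X) = - X.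
  by have /lfunP/(_ X) := comp; rewrite comp_lfunE opp_lfunE id_lfunE.
(* [g (J X) (J Y) = omega (J X) Y = - omega Y (J X) = - g Y (J (J X))]. *)
have JI X Y : g (J X) (J Y) = g X Y.
  by rewrite -assoc_endoE hermC expr1 mulN1r (assoc_endoE omega g) JJ linearNr opprK metricC.
have -> : ricci br g Z Z = ricci br g (J Z) (J Z).
  rewrite -!ricci_opE; have /lfunP/(_ Z) := herm.
  by rewrite !comp_lfunE => ->; rewrite JI.
apply: ricci_orthogonal_le0 => // X Y.
(* As [Z] is central, only [omega (br X Y) Z], that is [g (br X Y) (J Z)], survives in the
   closedness identity. *)
rewrite metricC -assoc_endoE; have := closed X Y Z.
by rewrite Zc (lie_skew lie Z Y) Zc oppr0 !linear0l !addr0.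
Qed.
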